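(* Let $\xi$ be a real random variable and $\zeta:[0,\infty)\to[0,\infty)$ a function such that $T_\xi(x)\le \exp(-\zeta(x))$ for all $x\ge 0$. Put $Z(y)=\zeta(e^y)$, $y\in\mathbb R$. Suppose that $Z$ is a twice continuously differentiable convex function on some interval $(C,\infty)$, and that there is a constant $C_1>0$ (with $[C_1,\infty)\subset(C,\infty)$) such that $\inf_{y\ge C_1}Z''(y)>0$. Then there is a finite constant $C_3$, not depending on $p$, such that $$|\xi|_p\le C_3\exp\bigl(Z^*(p)/p\bigr)\qquad\text{for all } p\ge 1;$$ equivalently, $\sup_{p\ge1}\,|\xi|_p\,\exp(-Z^*(p)/p)\le C_3<\infty$, i.e. the norm of $\xi$ in the Grand Lebesgue Space $G\psi$ with $\psi(p)=\exp(Z^*(p)/p)$ is at most $C_3$.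
   Context: $T_\xi(x)=\mathbf P(|\xi|\ge x)$ for $x\ge0$; $|\xi|_p=(\mathbf E|\xi|^p)^{1/p}$; $Z^*(p)=\sup_{y\in\mathbb R}(py-Z(y))$ is the Young–Fenchel transform, with values in $(-\infty,+\infty]$. For a positive function $\psi$ on $[1,\infty)$ the Grand Lebesgue Space norm is $\|\xi\|G\psi=\sup_{p\ge1}|\xi|_p/\psi(p)$. *)

(* Defs.v *)
From mathcomp Require Import all_boot all_order all_algebra.
From mathcomp Require Import all_classical all_reals all_analysis.
Import Order.TTheory GRing.Theory Num.Theory.
Import numFieldNormedType.Exports.

Set Implicit Arguments.
Unset Strict Implicit.
Unset Printing Implicit Defensive.

Local Open Scope ring_scope.
Local Open Scope ereal_scope.
Local Open Scope classical_set_scope.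

(* Two-sided tail; the library's [ccdf] is one-sided with a strict inequality. *)
Definition tail d (T : measurableType d) (R : realType) (P : probability T R)
    (xi : {RV P >-> R}) (x : R) : \bar R :=
  P [set w | (x <= `|xi w|)%R].

Definition young_fenchel (R : realType) (Z : R -> R) (p : R) : \bar R :=
  ereal_sup [set (p * y - Z y)%R%:E | y in [set: R]].

(* [psi] is extended-valued because exp (Z^*(p) / p) can be +oo a priori;
   as +oo^-1 = 0, such a [p] contributes 0 to the supremum. *)
Definition gls_norm d (T : measurableType d) (R : realType)
    (P : probability T R) (psi : R -> \bar R) (xi : {RV P >-> R}) : \bar R :=
  ereal_sup [set 'N[P]_p%:E [EFin \o xi] / psi p | p in `[1%R, +oo[].

(* Meant for open [D]: the derivatives are taken in the full real line. *)
Definition C2_on (R : realType) (D : set R) (f : R -> R) : Prop :=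
  [/\ {in D, forall y, derivable f y 1%R},
      {in D, forall y, derivable f^`() y 1%R} &
      {in D, continuous f^`(2)}].

(* Main.v *)
(** On the shell [e^n <= |xi| < e^(n+1)] one has [|xi|^p <= e^p e^(p n)], so
    [E |xi|^p <= e^p (1 + \sum_n exp (p n - Z n))], summing over naturals.
    The lower bound on [Z''] makes [Z] grow quadratically, hence
    [Z y >= (p + 1) y] as soon as [y >= D p], with [D] independent of [p >= 1].
    Therefore [p n - Z n <= Z^*(p) + D p + Z 0 - n] for all [n]: below [D p] by
    definition of [Z^*], above it because [(p + 1) n - Z n <= 0]. The series is
    then geometric, and the loss [exp (D p + O(p))] disappears into [C3^p]. *)

Require Import Defs.
From mathcomp Require Import all_boot all_order all_algebra.
From mathcomp Require Import all_classical all_reals all_analysis.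
From mathcomp Require Import measurable_realfun.
From mathcomp Require Import ring lra.
Import Order.TTheory GRing.Theory Num.Theory.
Import numFieldNormedType.Exports.

Set Implicit Arguments.
Unset Strict Implicit.
Unset Printing Implicit Defensive.

Local Open Scope ring_scope.
Local Open Scope classical_set_scope.

(** * Growth forced by a lower bound on the second derivative *)

Lemma is_derive_ge0_le (R : realType) (f df : R -> R) (a x : R) :
  (forall y, a <= y -> is_derive y 1 f (df y)) ->
  (forall y, a <= y -> 0 <= df y) -> a <= x -> f a <= f x.
Proof.
move=> fdf df_ge0 ax.
have [||y /itvP yax fE] := MVT_segment (f := f) (df := df) ax.
- by move=> y /itvP yax; apply: fdf; rewrite yax.
- apply: derivable_within_continuous => y /itvP yax.
  by have := fdf y; rewrite yax => /(_ isT) [].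
- by rewrite -subr_ge0 fE mulr_ge0 ?subr_ge0// df_ge0// yax.
Qed.

(** Monotonicity is applied twice: to [f'] minus a linear function of slope [c], then to [f] minus
    the quadratic polynomial, whose derivative is the bound just found for [f']. *)
Lemma quadratic_lower_bound (R : realType) (f : R -> R) (a c x : R) :
  (forall y, a <= y -> derivable f y 1) ->
  (forall y, a <= y -> derivable f^`()%classic y 1) ->
  (forall y, a <= y -> c <= f^`(2)%classic y) -> a <= x ->
  f a + f^`()%classic a * (x - a) + c / 2 * (x - a) ^+ 2 <= f x.
Proof.
move=> f1 f2 cf ax.
have f'_ge y : a <= y -> f^`()%classic a + c * (y - a) <= f^`()%classic y.
  move=> ay.
  suff : f^`()%classic a - c * a <= f^`()%classic y - c * y by lra.
  apply: (@is_derive_ge0_le _ (fun z => f^`()%classic z - c * z)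
    (fun z => f^`(2)%classic z - c)) => // z az; last by rewrite subr_ge0 cf.
  have f2z : is_derive z 1 f^`()%classic (f^`(2)%classic z).
    by rewrite derive1nS derive1n1 derive1E; exact/derivableP/f2.
  apply: is_derive_eq.
  by rewrite /GRing.scale/=; ring.
suff : f a - f^`()%classic a * a <=
    f x - (f^`()%classic a * x + c / 2 * (x - a) ^+ 2) by lra.
set g := fun z => f z - (f^`()%classic a * z + c / 2 * (z - a) ^+ 2).
suff : g a <= g x by rewrite /g subrr expr0n/= mulr0 addr0.
apply: (@is_derive_ge0_le _ g
  (fun z => f^`()%classic z - (f^`()%classic a + c * (z - a)))) => // z az.
  have fz : is_derive z 1 f (f^`()%classic z).
    by rewrite derive1E; exact/derivableP/f1.
  rewrite /g; apply: is_derive_eq.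
  by rewrite /GRing.scale/=; field.
by rewrite subr_ge0 f'_ge.
Qed.

(** Put t = y - a. The choice of [D] ensures t >= a and c t >= 4 p + |s|, so that (s + c t) t >= 4 p
    t = (2 p) (2 t) >= (p + 1) (t + a). Since p >= 1, the threshold can be taken linear in [p]. *)
Lemma superlinear_of_quadratic (R : realType) (f : R -> R) (a s c : R) :
  0 < c -> 0 < a ->
  (forall y, a <= y -> s * (y - a) + c * (y - a) ^+ 2 <= f y) ->
  exists2 D, 0 <= D & forall p y, 1 <= p -> D * p <= y -> (p + 1) * y <= f y.
Proof.
move=> c0 a0 fge; pose D := 2 * a + (4 + `|s|) / c.
have D'0 : 0 <= (4 + `|s|) / c by apply: divr_ge0; [exact: addr_ge0|exact: ltW].
have D0 : 0 <= D by rewrite addr_ge0// mulr_ge0// ltW.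
exists D => // p y p1 Dy.
have : 2 * a + (4 * p + `|s|) / c <= y.
  apply: le_trans Dy; rewrite /D [leRHS]mulrDl lerD//.
    by rewrite -[leLHS]mulr1 ler_wpM2l// mulr_ge0// ltW.
  rewrite mulrAC ler_wpM2r ?invr_ge0 ?(ltW c0)// [leRHS]mulrDl lerD2l.
  by rewrite -[leLHS]mulr1 ler_wpM2l.
have h0 : 0 <= (4 * p + `|s|) / c.
  by apply: divr_ge0; [apply: addr_ge0 => //; lra|exact: ltW].
move=> hy; have {}hy : (4 * p + `|s|) / c <= y - a - a by lra.
have ay : a <= y - a by lra.
apply: le_trans (fge y _); last by lra.
have : 4 * p + `|s| <= c * (y - a).
  by rewrite [leRHS]mulrC -ler_pdivrMr//; apply: le_trans hy _; lra.
have := ler_norm (- s); rewrite normrN => sn hc.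
set t := y - a in hy ay hc *.
have -> : y = t + a by rewrite /t; ring.
have : 4 * p * t <= (s + c * t) * t by apply: ler_wpM2r; lra.
have : (p + 1) * (t + a) <= (2 * p) * (2 * t) by apply: ler_pM; lra.
lra.
Qed.

(** * Moments bounded by tails at the points e^n *)

Lemma nneseries_expRN_le2 (R : realType) :
  (\sum_(0 <= n <oo) (expR (- n%:R : R))%:E <= 2%:E)%E.
Proof.
have e2 : (2 : R) <= expR 1 by have := expR_ge1Dx (1 : R); lra.
have e0 : (0 : R) < expR 1 by lra.
have eV : expR (- 1 : R) <= 2^-1 by rewrite expRN lef_pV2// posrE.
rewrite (_ : (fun _ => _) = EFin \o series (geometric 1 (expR (- 1 : R)))).
  have e1 : `|expR (- 1 : R)| < 1 by rewrite ger0_norm ?expR_ge0//; lra.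
  rewrite EFin_lim; last exact: is_cvg_geometric_series.
  rewrite (cvg_lim _ (@cvg_geometric_series _ 1 _ e1))// lee_fin.
  by rewrite mul1r invf_ple ?posrE//; lra.
apply/funext => n; rewrite /= /series/= -sumEFin.
by apply: eq_bigr => i _; rewrite /geometric/= mul1r -expRM_natl mulrN1.
Qed.

(** The summand 1 covers x <= 1; for x > 1 the single index n = floor (ln x) suffices. The
    indicators are those of the half-lines [e^n, +oo) rather than of the shells, so that integrating
    them gives tails directly. *)
Lemma powR_le_nneseries (R : realType) (p x : R) : 0 <= p -> 0 <= x ->
  ((x `^ p)%:E <= (expR p)%:E *
   (1 + \sum_(0 <= n <oo) (expR (p * n%:R))%:E *
                          (\1_[set y | expR n%:R <= y] x)%:E))%E.
Proof.
move=> p0 x0.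
have sum0 n : (0 <= (expR (p * n%:R))%:E *
    (\1_[set y : R | expR n%:R <= y] x)%:E)%E.
  by rewrite mule_ge0// lee_fin ?expR_ge0.
have [x1|x1] := leP x 1.
  apply: (@le_trans _ _ ((expR p)%:E * 1)%E).
    rewrite mule1 lee_fin (@le_trans _ _ 1)//; last first.
      by rewrite -expR0 ler_expR.
    by apply: le_trans (ge0_ler_powR p0 _ _ x1) _; rewrite ?nnegrE// powR1.
  by rewrite lee_wpmul2l ?lee_fin ?expR_ge0// leeDl// nneseries_ge0.
have xp : 0 < x by lra.
pose n := Num.truncn (ln x).
have lnx0 : 0 <= ln x by rewrite ln_ge0// ltW.
have /andP[nx xn] := truncn_itv lnx0.
apply: (@le_trans _ _ ((expR p)%:E * (expR (p * n%:R))%:E)%E).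
  rewrite -EFinM lee_fin -expRD /powR gt_eqF// ler_expR.
  by rewrite -[X in X + _]mulr1 -mulrDr ler_wpM2l// addrC natr1; exact: ltW.
rewrite lee_wpmul2l ?lee_fin ?expR_ge0//.
apply: le_trans (leeDr _ _); last by rewrite lee_fin.
(* The partial sum up to [n.+1] has the term of index [n] as its last one; the others are
   dropped. *)
apply: le_trans (nneseries_lim_ge n.+1 _); last by [].
rewrite big_nat_recr//= -[leLHS]add0e leeD ?sume_ge0//.
by rewrite indicE mem_set ?mule1//= -[leRHS](lnK xp) ler_expR.
Qed.

Lemma measurable_norm_ge (d : measure_display) (T : measurableType d)
    (R : realType) (P : probability T R) (xi : {RV P >-> R}) (x : R) :
  measurable [set w | x <= `|xi w|].
Proof.
rewrite (_ : mkset _ = [set: T] `&` (Num.norm \o xi) @^-1` `[x, +oo[).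
  by apply: measurableT_comp.
by apply/seteqP; split => w /=; rewrite in_itv/= andbT; [split|case].
Qed.

Lemma moment_le_tail_series (d : measure_display) (T : measurableType d)
    (R : realType) (P : probability T R) (xi : {RV P >-> R}) (p : R) :
  0 <= p ->
  (\int[P]_w (`|(xi w)%:E| `^ p) <= (expR p)%:E *
   (1 + \sum_(0 <= n <oo) (expR (p * n%:R))%:E * tail xi (expR n%:R)))%E.
Proof.
move=> p0; pose S (n : nat) := [set w | expR n%:R <= `|xi w|].
pose h n : T -> \bar R := EFin \o \1_(S n).
pose g n w : \bar R := ((expR (p * n%:R))%:E * h n w)%E.
have mS n : measurable (S n) := measurable_norm_ge xi _.
have mh n : measurable_fun [set: T] (h n).
  exact/measurable_EFinP/measurable_indic.
have g0 n w : (0 <= g n w)%E by rewrite mule_ge0// lee_fin ?expR_ge0.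
have mg n : measurable_fun [set: T] (g n) by exact: measurable_funeM.
have msum : measurable_fun [set: T] (fun w => \sum_(0 <= n <oo) g n w)%E.
  exact: ge0_emeasurable_sum.
apply: (@le_trans _ _ (\int[P]_w
    ((expR p)%:E * (1 + \sum_(0 <= n <oo) g n w)))%E).
  apply: ge0_le_integral => //.
  - by move=> w _; rewrite poweR_ge0.
  - apply: (measurableT_comp (measurable_poweR p)).
    by apply: measurableT_comp => //; exact/measurable_EFinP.
  - by apply: measurable_funeM; exact: emeasurable_funD.
  - by move=> w _; rewrite poweR_EFin; exact: powR_le_nneseries.
rewrite ge0_integralZl ?lee_fin ?expR_ge0//; first last.
- by move=> w _; rewrite adde_ge0// nneseries_ge0.
- exact: emeasurable_funD.
rewrite lee_wpmul2l ?lee_fin ?expR_ge0// ge0_integralD//; last first.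
  by move=> w _; rewrite nneseries_ge0.
have -> : (\int[P]_w 1 = 1)%E.
  by rewrite integral_cst// mul1e; exact: probability_setT.
rewrite leeD2l// integral_nneseries//.
apply: lee_nneseries => n => [_ _|_]; first exact: integral_ge0.
rewrite ge0_integralZl ?lee_fin ?expR_ge0//.
  by rewrite integral_indic// setIT.
by move=> w _; rewrite lee_fin.
Qed.

(** * From the Young-Fenchel transform to the norms *)

Lemma young_fenchel_ge (R : realType) (Z : R -> R) (p y : R) :
  ((p * y - Z y)%:E <= young_fenchel Z p)%E.
Proof. by apply: ereal_sup_ubound; exists y. Qed.

(* Shifting the exponent by one buys the summable factor [exp (- n)], and
   superlinearity of [Z] makes the shift cost at most [D * p]. *)
Lemma moment_bound (d : measure_display) (T : measurableType d) (R : realType)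
    (P : probability T R) (xi : {RV P >-> R}) (Z : R -> R) (D p s : R) :
  (forall n : nat, (tail xi (expR n%:R) <= (expR (- Z n%:R))%:E)%E) ->
  0 <= Z 0 -> 0 <= D -> 1 <= p ->
  (forall y, D * p <= y -> (p + 1) * y <= Z y) ->
  young_fenchel Z p = s%:E ->
  (\int[P]_w (`|(xi w)%:E| `^ p) <= (expR ((4 + D + Z 0) * p + s))%:E)%E.
Proof.
move=> tailZ Z0 D0 p1 superlin sE.
have sge y : p * y - Z y <= s by rewrite -lee_fin -sE young_fenchel_ge.
have s0 : - Z 0 <= s by have := sge 0; rewrite mulr0 sub0r.
have Dp0 : 0 <= D * p by apply: mulr_ge0; lra.
(* [s] may be negative; the point y = 0 only gives s >= - Z 0, so adding [Z 0] makes [A]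
   nonnegative. *)
pose A := s + D * p + Z 0.
have A0 : 0 <= A by rewrite /A; lra.
have term_le (n : nat) : p * n%:R - Z n%:R <= A - n%:R.
  have [/superlin nZ|nD] := leP (D * p) n%:R; first by lra.
  by have := sge n%:R; rewrite /A; lra.
apply: le_trans (moment_le_tail_series _ _) _; first by lra.
apply: (@le_trans _ _ ((expR p)%:E * (1 + (expR A)%:E * 2%:E))%E).
  rewrite lee_wpmul2l ?lee_fin ?expR_ge0// leeD2l//.
  apply: (@le_trans _ _
      (\sum_(0 <= n <oo) (expR A)%:E * (expR (- n%:R))%:E)%E).
    apply: lee_nneseries => n; first by rewrite mule_ge0 ?lee_fin ?expR_ge0.
    move=> _; apply: (@le_trans _ _
      ((expR (p * n%:R))%:E * (expR (- Z n%:R))%:E)%E).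
      by rewrite lee_wpmul2l ?lee_fin ?expR_ge0.
    by rewrite -!EFinM lee_fin -!expRD ler_expR.
  rewrite nneseriesZl; last by move=> n _; rewrite lee_fin expR_ge0.
  by rewrite lee_wpmul2l ?lee_fin ?expR_ge0// nneseries_expRN_le2.
rewrite (_ : (_ * _)%E = (expR p * (1 + expR A * 2))%:E)// lee_fin.
(* Since A >= 0, 1 + 2 e^A <= 3 e^A <= e^(3 + A). With p >= 1, the total exponent p + 3 + A is at
   most (4 + D + Z 0) p + s. *)
have eA : 1 <= expR A by rewrite -expR0 ler_expR.
have e3 : (3 : R) <= expR 3 by have := expR_ge1Dx (3 : R); lra.
apply: (@le_trans _ _ (expR p * (expR 3 * expR A))).
  rewrite ler_wpM2l ?expR_ge0//.
  have : 3 * expR A <= expR 3 * expR A by rewrite ler_wpM2r ?expR_ge0.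
  lra.
rewrite -!expRD ler_expR /A.
have : Z 0 <= Z 0 * p by rewrite -[leLHS]mulr1 ler_wpM2l.
lra.
Qed.

(** The p-th root divides the exponent of [moment_bound] by [p]: the part linear in [p] becomes a
    constant and [s] becomes s / p. If the transform is +oo, the right-hand side is +oo. *)
Lemma Lnorm_bound (d : measure_display) (T : measurableType d) (R : realType)
    (P : probability T R) (xi : {RV P >-> R}) (Z : R -> R) (D p : R) :
  (forall n : nat, (tail xi (expR n%:R) <= (expR (- Z n%:R))%:E)%E) ->
  0 <= Z 0 -> 0 <= D -> 1 <= p ->
  (forall y, D * p <= y -> (p + 1) * y <= Z y) ->
  ('N[P]_p%:E [EFin \o xi] <=
     (expR (4 + D + Z 0))%:E * expeR (young_fenchel Z p / p%:E))%E.
Proof.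
move=> tailZ Z0 D0 p1 superlin.
have p0 : 0 < p by lra.
case sE : (young_fenchel Z p) => [s| |]; last first.
- by have := young_fenchel_ge Z p 0; rewrite sE leeNy_eq.
- rewrite inver gt_eqF// gt0_mulye ?lte_fin ?invr_gt0//=.
  by rewrite gt0_muley ?lte_fin ?expR_gt0// leey.
have := moment_bound tailZ Z0 D0 p1 superlin sE.
move=> /(gt0_ler_poweR (r := p^-1)); rewrite invr_ge0 => /(_ (ltW p0)).
rewrite !in_itv/= !leey !andbT integral_ge0// lee_fin expR_ge0.
move=> /(_ isT isT).
rewrite Lnorm.unlock => /le_trans; apply.
rewrite inver gt_eqF//= -EFinM lee_fin -expRD -expRM ler_expR.
by rewrite mulrDl mulfK ?gt_eqF.
Qed.

Theorem theorem2p2 (d : measure_display) (T : measurableType d) (R : realType)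
    (P : probability T R) (xi : {RV P >-> R}) (zeta : R -> R)
    (zeta_ge0 : forall x : R, 0 <= x -> 0 <= zeta x)
    (tail_le : forall x : R, 0 <= x ->
       (tail xi x <= (expR (- zeta x))%:E)%E)
    (Z : R -> R) (ZE : forall y : R, Z y = zeta (expR y))
    (C C1 : R)
    (Z_C2 : C2_on `]C, +oo[ Z)
    (Z_convex : convex_function (`]C, +oo[ : set R^o) Z)
    (C1_gt0 : 0 < C1)
    (C_lt_C1 : C < C1)
    (Z2_inf : (0 < ereal_inf [set (Z^`(2)%classic y)%:E | y in `[C1, +oo[])%E) :
  exists C3 : R,
    [/\ forall p : R, 1 <= p ->
          ('N[P]_p%:E [EFin \o xi] <=
             C3%:E * expeR (young_fenchel Z p / p%:E))%E,
        (ereal_sup [set 'N[P]_p%:E [EFin \o xi] *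
                        expeR (- (young_fenchel Z p / p%:E))
                   | p in `[1%R, +oo[] <= C3%:E)%E &
        (gls_norm (fun p : R => expeR (young_fenchel Z p / p%:E)) xi
           <= C3%:E)%E].
Proof.
have [c c0 cZ] : exists2 c, 0 < c & forall y, C1 <= y -> c <= Z^`(2)%classic y.
  have infle y : C1 <= y ->
      (ereal_inf [set (Z^`(2)%classic y)%:E | y in `[C1, +oo[] <=
       (Z^`(2)%classic y)%:E)%E.
    move=> C1y; apply: ereal_inf_lbound; exists y => //=.
    by rewrite in_itv/= C1y.
  (* The value at [C1] excludes an infinite infimum +oo, positivity excludes -oo. *)
  case: ereal_inf Z2_inf infle => [c| |] c0 infle.
  - by exists c; [rewrite -lte_fin|move=> y /infle; rewrite lee_fin].
  - by have := infle _ (lexx C1).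
  - by [].
have CZ y : C1 <= y -> y \in (`]C, +oo[ : set R).
  by move=> C1y; rewrite inE/= in_itv/= andbT (lt_le_trans C_lt_C1).
have [Z1 Z2 _] := Z_C2.
have Z_ge0 y : 0 <= Z y by rewrite ZE zeta_ge0 ?expR_ge0.
have [||y C1y|D D0 superlin] :=
    @superlinear_of_quadratic _ Z C1 (Z^`()%classic C1) (c / 2).
- by rewrite divr_gt0.
- by [].
- have := @quadratic_lower_bound _ Z C1 c y (fun y h => Z1 y (CZ y h))
    (fun y h => Z2 y (CZ y h)) cZ C1y.
  by have := Z_ge0 C1; lra.
have tailZ (n : nat) : (tail xi (expR n%:R) <= (expR (- Z n%:R))%:E)%E.
  by rewrite ZE tail_le ?expR_ge0.
have NZ p : 1 <= p -> ('N[P]_p%:E [EFin \o xi] <=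
    (expR (4 + D + Z 0))%:E * expeR (young_fenchel Z p / p%:E))%E.
  by move=> p1; apply: Lnorm_bound => // y; exact: superlin.
(* [b] stands for both forms of the factor, the exponential of the opposite and the inverse of
   [psi p]; they agree at infinite values too. *)
have NZ' p (b : \bar R) : 1 <= p ->
    b = expeR (- (young_fenchel Z p / p%:E)) ->
    ('N[P]_p%:E [EFin \o xi] * b <= (expR (4 + D + Z 0))%:E)%E.
  move=> p1 ->; have := NZ _ p1; case: (_ / _)%E => [r| |] /=.
  - by rewrite expRN -EFinM lee_pdivrMr ?expR_gt0.
  - by rewrite mule0 lee_fin expR_ge0.
  (* Here [b] is +oo, but the norm vanishes and 0 * +oo = 0. *)
  - rewrite mule0 => N0; have /eqP -> : 'N[P]_p%:E [EFin \o xi]%E == 0%E.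
      by rewrite eq_le N0 Lnorm_ge0.
    by rewrite mul0e lee_fin expR_ge0.
exists (expR (4 + D + Z 0)); split => //.
- apply: ge_ereal_sup => _ [p /= + <-]; rewrite in_itv/= andbT => p1.
  exact: NZ'.
- apply: ge_ereal_sup => _ [p /= + <-]; rewrite in_itv/= andbT => p1.
  apply: NZ' => //.
  case: (_ / _)%E => [r| |] /=; rewrite ?invey ?inve0//.
  by rewrite inver gt_eqF ?expR_gt0// expRN.
Qed.
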